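(* Let $\mathcal{A}=(a_i)_{i=1}^\infty$ be a strictly increasing sequence of positive integers such that $\gcd(a_i,a_j)=1$ for all $1\leqslant i<j\leqslant 4$, and let $k>4$ be an integer. Then $$p_{\mathcal{A}}(n,k)^2>\left(1+\frac{1}{n^2}\right)p_{\mathcal{A}}(n+1,k)\,p_{\mathcal{A}}(n-1,k)$$ holds for each integer $n>2k^2(k-1)!\,(a_1a_2a_3)^3a_k^{k+3}e^{1/a_k}$. In particular, the sequence $(p_{\mathcal{A}}(n,k))_{n=1}^\infty$ is log-concave for all such $n$, that is, $p_{\mathcal{A}}(n,k)^2>p_{\mathcal{A}}(n+1,k)\,p_{\mathcal{A}}(n-1,k)$ for all such $n$.
   Context: For a sequence $\mathcal{A}=(a_i)_{i=1}^\infty$ of positive integers, a positive integer $k$ and an integer $n\geqslant 0$, $p_{\mathcal{A}}(n,k)$ denotes the number of partitions of $n$ with all parts in $\{a_1,\ldots,a_k\}$ (order of parts is irrelevant), i.e. $\sum_{n\geqslant 0}p_{\mathcal{A}}(n,k)x^n=\prod_{i=1}^k\frac{1}{1-x^{a_i}}$. Log-concavity at $n$ is understood in the strict sense. $e$ is the base of the natural logarithm. *)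

(* Defs.v *)
From mathcomp Require Import all_boot all_order all_algebra.
From mathcomp Require Import all_classical all_reals all_analysis.

Set Implicit Arguments.
Unset Strict Implicit.
Unset Printing Implicit Defensive.

(* Sequences (a_i)_{i >= 1} are functions nat -> nat whose value at 0 is never
   used. A partition of n with parts in {a_1, ..., a_k} is encoded by its
   multiplicities: m i is the number of parts equal to a_(i+1), so that the
   count is the coefficient of x^n in \prod_(1 <= i <= k) 1 / (1 - x^(a_i)).
   Since the a_i are positive no multiplicity exceeds n, hence the codomain
   'I_n.+1. *)
Definition restricted_partitions (a : nat -> nat) (n k : nat) :
    {set {ffun 'I_k -> 'I_n.+1}} :=
  [set m : {ffun 'I_k -> 'I_n.+1} | \sum_(i < k) m i * a i.+1 == n]%N.

Definition pA (a : nat -> nat) (n k : nat) : nat :=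
  #|restricted_partitions a n k|.

Definition log_concave_at (u : nat -> nat) (n : nat) : Prop :=
  (u n.+1 * u n.-1 < u n ^ 2)%N.

(* Main.v *)
Require Import Defs.
From HB Require Import structures.
From mathcomp Require Import all_boot all_order all_algebra.
From mathcomp Require Import all_classical all_reals all_analysis.
From mathcomp Require Import ring lra zify.

(** Why the theorem holds.  Let F be the generating function of p = p_A(., k),
    let z = 1 - X and N = a_1 a_2 a_3.  The coefficients of z F and z^2 F are
    the first difference d(n) = p(n) - p(n-1) and the second difference
    D(n+1) = p(n+1) - 2 p(n) + p(n-1), and

      p(n)^2 - p(n+1) p(n-1) = d(n)^2 - D(n+1) p(n-1).

    If p is close to c n^(k-1), the right-hand side is close to
    (k-1) c^2 n^(2k-4), while p(n+1) p(n-1) / n^2 is close to c^2 n^(2k-4).  So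
    it is enough to know p, d and D up to a relative error of order 1/n, with
    explicit constants.

    The point is that p itself is only a quasi-polynomial, and that
    differencing could let its periodic part take over.  It does not, because
    four pairwise coprime parts make that part of degree at most k-4.  In
    elementary terms, put phi_a = 1 + X + ... + X^(a-1), so that
    1 / (1 - X^a) = 1 / (z phi_a).  For coprime a and b a Bezout relation
    u a = v b + 1 reads phi_a A - X phi_b B = 1 with explicit sparse A and B,
    hence 1 / (phi_a phi_b) = A / phi_b - X B / phi_a.  Iterating,
    1 / (z phi_a phi_b phi_c phi_d) is a combination of the series 1 / (z phi_a)
    = 1 / (1 - X^a), whose coefficients are 0 or 1; so its coefficients are at
    most (2M)^3 for M >= a, b, c, d (geo4_bound).  On the other hand
    phi_a phi_b phi_c = N mod z, hence N / (z phi_a phi_b phi_c) is 1 / z plus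
    a polynomial times 1 / (phi_a phi_b phi_c) (geo_triple).  Multiplying by
    the remaining factors, N z^2 F equals, up to an error of lower degree, the
    series 1 / z * prod_(i >= 4) 1 / (1 - X^(a_i)) (approx_bounded_partitions).

    The coefficient of X^n in that series counts the nonnegative integer points
    of the simplex sum_(i >= 4) a_i x_i <= n, which is bounded on both sides by
    volumes (bounded_partitions_bounds).  Multiplying by 1 / z amounts to adding
    a part equal to 1, so the same two facts also estimate z F and F.  What is
    left is an inequality between real numbers (difference_gap) and the check
    that the explicit lower bound on n leaves enough room
    (explicit_bound_suffices). *)

Set Implicit Arguments.
Unset Strict Implicit.
Unset Printing Implicit Defensive.

Import Order.TTheory GRing.Theory Num.Theory.
Local Open Scope ring_scope.

(** * The ring of formal power series *)

(** A name of its own keeps the convolution product apart from the pointwise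
    product that functions [nat -> R] already carry. *)
Definition fps (R : comNzRingType) := nat -> R.

HB.instance Definition _ (R : comNzRingType) := gen_eqMixin (fps R).
HB.instance Definition _ (R : comNzRingType) := gen_choiceMixin (fps R).

Section FpsRing.
Variable R : comNzRingType.
Implicit Types f g h : fps R.

Definition fps_zero : fps R := fun=> 0.
Definition fps_opp f : fps R := fun n => - f n.
Definition fps_add f g : fps R := fun n => f n + g n.
Definition fps_one : fps R := fun n => (n == 0%N)%:R.
Definition fps_mul f g : fps R := fun n => \sum_(i < n.+1) f i * g (n - i)%N.

Fact fps_addA : associative fps_add.
Proof. by move=> f g h; apply/funext => n; exact: addrA. Qed.
Fact fps_addC : commutative fps_add.
Proof. by move=> f g; apply/funext => n; exact: addrC. Qed.
Fact fps_add0 : left_id fps_zero fps_add.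
Proof. by move=> f; apply/funext => n; exact: add0r. Qed.
Fact fps_addN : left_inverse fps_zero fps_opp fps_add.
Proof. by move=> f; apply/funext => n; exact: addNr. Qed.

HB.instance Definition _ :=
  GRing.isZmodule.Build (fps R) fps_addA fps_addC fps_add0 fps_addN.

(** Truncation transfers the associativity and commutativity of the product of
    polynomials to the convolution product. *)
Definition fps_trunc n f : {poly R} := \poly_(i < n.+1) f i.

Lemma fps_mul_trunc n f g m : (m <= n)%N ->
  fps_mul f g m = (fps_trunc n f * fps_trunc n g)`_m.
Proof.
move=> mn; rewrite /fps_trunc coefM; apply: eq_bigr => i _.
rewrite !coef_poly !ltnS (leq_trans (leq_subr _ _) mn).
by rewrite (leq_trans _ mn) // -ltnS.
Qed.

Fact fps_mulA : associative fps_mul.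
Proof.
move=> f g h; apply/funext => n.
transitivity (fps_trunc n f * (fps_trunc n g * fps_trunc n h))`_n.
  rewrite coefM; apply: eq_bigr => i _.
  rewrite (@fps_mul_trunc n) ?leq_subr // /fps_trunc.
  by congr (_ * _); rewrite coef_poly ltn_ord.
rewrite mulrA coefM; apply: eq_bigr => i _.
rewrite -(@fps_mul_trunc n) -1?ltnS // /fps_trunc.
by congr (_ * _); rewrite coef_poly ltnS leq_subr.
Qed.

Fact fps_mulC : commutative fps_mul.
Proof.
by move=> f g; apply/funext => n; rewrite !(fps_mul_trunc _ _ (leqnn n)) mulrC.
Qed.

Fact fps_mul1 : left_id fps_one fps_mul.
Proof.
move=> f; apply/funext => n; rewrite /fps_mul big_ord_recl /= mul1r subn0.
by rewrite big1 ?addr0 // => i _; rewrite mul0r.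
Qed.

Fact fps_mulDl : left_distributive fps_mul fps_add.
Proof.
move=> f g h; apply/funext => n; rewrite /fps_mul /fps_add -big_split /=.
by apply: eq_bigr => i _; rewrite mulrDl.
Qed.

Fact fps_oneN0 : fps_one != 0.
Proof.
by apply/eqP => /(congr1 (fun f : fps R => f 0%N)) /eqP; rewrite oner_eq0.
Qed.

HB.instance Definition _ := GRing.Zmodule_isComNzRing.Build (fps R)
  fps_mulA fps_mulC fps_mul1 fps_mulDl fps_oneN0.

Lemma coef_fpsM f g n : (f * g) n = \sum_(i < n.+1) f i * g (n - i)%N.
Proof. by []. Qed.

Lemma coef_fps1 n : (1 : fps R) n = (n == 0%N)%:R.
Proof. by []. Qed.

Lemma coef_fpsD f g n : (f + g) n = f n + g n.
Proof. by []. Qed.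

Lemma coef_fpsN f n : (- f) n = - f n.
Proof. by []. Qed.

Lemma coef_fps_sum (I : Type) (r : seq I) (P : pred I) (F : I -> fps R) n :
  (\sum_(i <- r | P i) F i) n = \sum_(i <- r | P i) F i n.
Proof. by apply: (big_morph (fun f : fps R => f n)). Qed.

Lemma coef_fpsMn f m n : (f *+ m) n = f n *+ m.
Proof. by elim: m => [//|m IH]; rewrite !mulrS coef_fpsD IH. Qed.

Definition fX : fps R := fun n => (n == 1%N)%:R.

Lemma coef_fXM f n : (fX * f) n = if n is m.+1 then f m else 0.
Proof.
case: n => [|n]; first by rewrite coef_fpsM big_ord1 mul0r.
rewrite coef_fpsM big_ord_recl mul0r add0r big_ord_recl /= mul1r subn1 /=.
by rewrite big1 ?addr0 // => i _; rewrite mul0r.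
Qed.

Lemma coef_fXnM f m n : (fX ^+ m * f) n = if (m <= n)%N then f (n - m)%N else 0.
Proof.
elim: m n => [|m IH] n; first by rewrite expr0 mul1r subn0.
by rewrite exprS -mulrA coef_fXM; case: n => // n; rewrite IH ltnS subSS.
Qed.

Lemma coef_fXn m n : (fX ^+ m) n = (n == m)%:R.
Proof.
rewrite -[fX ^+ m]mulr1 coef_fXnM; have [mn|nm] := leqP m n.
  by rewrite coef_fps1 subn_eq0 eqn_leq mn andbT.
by rewrite ltn_eqF.
Qed.

(** The geometric series 1 / (1 - X^a), see [geoM]. *)
Definition geo a : fps R := fun n => (a %| n)%:R.

Lemma geoM a : (0 < a)%N -> (1 - fX ^+ a) * geo a = 1.
Proof.
move=> a0; apply/funext => n; rewrite mulrBl mul1r coef_fpsD coef_fpsN coef_fXnM.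
rewrite /geo coef_fps1; case: leqP => an.
  by rewrite dvdn_subl // subrr gtn_eqF // (leq_trans a0).
rewrite subr0; case: (posnP n) => [->|n0]; first by rewrite dvdn0.
by rewrite gtnNdvd // gtn_eqF.
Qed.

End FpsRing.

(** * Bezout identities for the series 1 / (1 - X^a) *)

Section PhiIdentities.
Variable R : comNzRingType.
Local Notation z := (1 - fX R).

(** (1 - X^a) / (1 - X) *)
Definition phi a : fps R := \sum_(i < a) fX R ^+ i.

Lemma zphi a : z * phi a = 1 - fX R ^+ a.
Proof. by rewrite -opprB -(opprB _ 1) subrX1 -mulNr. Qed.

Lemma zgeo1 : z * geo R 1 = 1.
Proof. by rewrite -[X in 1 - X]expr1 geoM. Qed.

Lemma z_inj : injective ( *%R z).
Proof.
move=> f g /(congr1 ( *%R (geo R 1))).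
by rewrite !mulrA ![geo R 1 * _]mulrC zgeo1 !mul1r.
Qed.

Lemma phi_geo a : (0 < a)%N -> phi a * geo R a = geo R 1.
Proof. by move=> a0; apply: z_inj; rewrite mulrA zphi geoM // zgeo1. Qed.

(** (1 - X^(u a)) / (1 - X^a) *)
Definition phi_in a u : fps R := \sum_(i < u) fX R ^+ (a * i).

Lemma phiM a u : phi (u * a) = phi a * phi_in a u.
Proof.
apply: z_inj; rewrite mulrA !zphi /phi_in.
under eq_bigr => i _ do rewrite exprM.
by rewrite -opprB -(opprB _ 1) mulnC exprM subrX1 mulNr.
Qed.

Lemma phiS n : phi n.+1 = 1 + fX R * phi n.
Proof.
rewrite /phi big_ord_recl expr0 mulr_sumr.
by congr (1 + _); apply: eq_bigr => i _; rewrite -exprS.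
Qed.

(** Partial fractions: 1 / (phi a * phi b), multiplied by 1 / (1 - X), splits
    because the relation [u * a = v * b + 1] gives the polynomial Bezout relation
    [phi (u * a) - X * phi (v * b) = 1], whose two terms are multiples of
    [phi a] and [phi b]. *)
Lemma geo_pair a b u v : (0 < a)%N -> (0 < b)%N -> (u * a = (v * b).+1)%N ->
  z * geo R a * geo R b = phi_in a u * geo R b - fX R * phi_in b v * geo R a.
Proof.
move=> a0 b0 uv.
have bez : phi a * phi_in a u - fX R * (phi b * phi_in b v) = 1.
  by rewrite -!phiM uv phiS; ring.
have pa := phi_geo a0; have pb := phi_geo b0; have z1 := zgeo1.
rewrite -[LHS]mulr1 -[X in _ * X = _]bez.
transitivity ((z * (phi a * geo R a)) * phi_in a u * geo R b
   - fX R * ((z * (phi b * geo R b)) * phi_in b v) * geo R a).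
  by ring.
by rewrite pa pb z1 !mul1r.
Qed.

(** (a - phi a) / (1 - X): since [phi a] takes the value [a] at X = 1, the
    quotient is a polynomial. *)
Definition psi a : fps R := \sum_(i < a) phi i.

Lemma zpsi a : z * psi a = a%:R - phi a.
Proof.
rewrite /psi mulr_sumr; under eq_bigr => i _ do rewrite zphi.
by rewrite sumrB sumr_const card_ord.
Qed.

(** The pole of 1 / ((1 - X) phi_a phi_b phi_c) at X = 1 has residue given by
    1 / (a b c).  The difference a b c - phi_a phi_b phi_c is divisible by 1 - X;
    replacing the three factors one at a time gives the quotient in terms of
    [psi]. *)
Lemma geo_triple a b c : (0 < a)%N -> (0 < b)%N -> (0 < c)%N ->
  (a * b * c)%:R * (z ^+ 2 * geo R a * geo R b * geo R c) =
  geo R 1 + (psi a * b%:R * c%:R + phi a * psi b * c%:R + phi a * phi b * psi c)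
            * (z ^+ 3 * geo R a * geo R b * geo R c).
Proof.
move=> a0 b0 c0.
have pa := phi_geo a0; have pb := phi_geo b0; have pc := phi_geo c0.
have z1 := zgeo1; rewrite !natrM.
have -> : a%:R = phi a + z * psi a by rewrite zpsi; ring.
have -> : b%:R = phi b + z * psi b by rewrite zpsi; ring.
have -> : c%:R = phi c + z * psi c by rewrite zpsi; ring.
have -> : geo R 1 = (z * geo R 1) ^+ 2 * geo R 1 by rewrite z1; ring.
transitivity ((z * (phi a * geo R a)) * (z * (phi b * geo R b)) *
     (phi c * geo R c) +
   z * (psi a * (phi b + z * psi b) * (phi c + z * psi c) +
        phi a * psi b * (phi c + z * psi c) + phi a * phi b * psi c) *
    (z ^+ 2 * geo R a * geo R b * geo R c)).
  by ring.
by rewrite pa pb pc; ring.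
Qed.

End PhiIdentities.

(** * Bounds on coefficients *)

Section Bounds.
Variable R : realFieldType.
Implicit Types (f g h : fps R) (C D : R).
Local Notation z := (1 - fX R).

Definition sup_bounded C f := forall n, `|f n| <= C.
(** The norm of [f] as a multiplication operator on bounded series.  It plays the
    part of the sum of the absolute values of the coefficients of a polynomial,
    and it is submultiplicative by construction. *)
Definition mul_bounded C f :=
  forall D g, sup_bounded D g -> sup_bounded (C * D) (f * g).

Lemma sup_bounded_ge0 C f : sup_bounded C f -> 0 <= C.
Proof. by move=> /(_ 0%N); apply: le_trans. Qed.

Lemma sup_boundedD C D f g :
  sup_bounded C f -> sup_bounded D g -> sup_bounded (C + D) (f + g).
Proof. by move=> Cf Dg n; rewrite coef_fpsD (le_trans (ler_normD _ _)) // lerD. Qed.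

Lemma sup_bounded_le C D f : C <= D -> sup_bounded C f -> sup_bounded D f.
Proof. by move=> CD Cf n; apply: le_trans CD. Qed.

Lemma sup_bounded_geo a : sup_bounded 1 (geo R a).
Proof. by move=> n; rewrite /geo normr_nat lern1 leq_b1. Qed.

Lemma mul_bounded_le C D f : C <= D -> mul_bounded C f -> mul_bounded D f.
Proof.
move=> CD Cf E g Eg; apply: sup_bounded_le (Cf _ _ Eg).
by rewrite ler_wpM2r // (sup_bounded_ge0 Eg).
Qed.

Lemma mul_boundedD C D f g :
  mul_bounded C f -> mul_bounded D g -> mul_bounded (C + D) (f + g).
Proof. by move=> Cf Dg E h Eh; rewrite !mulrDl; apply: sup_boundedD; auto. Qed.

Lemma mul_boundedM C D f g :
  mul_bounded C f -> mul_bounded D g -> mul_bounded (C * D) (f * g).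
Proof. by move=> Cf Dg E h Eh; rewrite -!mulrA; auto. Qed.

Lemma mul_boundedN C f : mul_bounded C f -> mul_bounded C (- f).
Proof.
by move=> Cf D g Dg n; rewrite mulNr coef_fpsN normrN; apply: (Cf _ _ Dg).
Qed.

Lemma mul_bounded0 : mul_bounded 0 0.
Proof. by move=> D g _ n; rewrite !mul0r normr0. Qed.

Lemma mul_boundedX m : mul_bounded 1 (fX R ^+ m).
Proof.
move=> D g Dg n; rewrite mul1r coef_fXnM; case: ifP => // _.
by rewrite normr0 (sup_bounded_ge0 Dg).
Qed.

Lemma mul_bounded_sum n (F : nat -> fps R) (C : nat -> R) :
  (forall i, (i < n)%N -> mul_bounded (C i) (F i)) ->
  mul_bounded (\sum_(i < n) C i) (\sum_(i < n) F i).
Proof.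
elim: n => [|n IH] CF; first by rewrite !big_ord0; exact: mul_bounded0.
rewrite !big_ord_recr /=; apply: mul_boundedD; last exact: CF.
by apply: IH => i /ltnW; apply: CF.
Qed.

Lemma mul_bounded_nat n : mul_bounded n%:R n%:R.
Proof.
elim: n => [|n IH]; first exact: mul_bounded0.
by rewrite -natr1 -[in X in mul_bounded _ X]natr1; apply: mul_boundedD IH (mul_boundedX 0).
Qed.

Lemma mul_bounded_phi_in a u : mul_bounded u%:R (phi_in R a u).
Proof.
have -> : u%:R = \sum_(i < u) 1 :> R by rewrite sumr_const card_ord.
apply: (@mul_bounded_sum _ (fun i => fX R ^+ (a * i)) (fun=> 1)) => i _.
exact: mul_boundedX.
Qed.

Lemma mul_bounded_phi a : mul_bounded a%:R (phi R a).
Proof.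
have -> : a%:R = \sum_(i < a) 1 :> R by rewrite sumr_const card_ord.
apply: (@mul_bounded_sum _ (fun i => fX R ^+ i) (fun=> 1)) => i _.
exact: mul_boundedX.
Qed.

Lemma mul_bounded_psi a : mul_bounded (a%:R ^+ 2) (psi R a).
Proof.
have -> : a%:R ^+ 2 = \sum_(i < a) a%:R :> R.
  by rewrite sumr_const card_ord expr2 mulr_natl.
apply: (@mul_bounded_sum _ (phi R) (fun=> a%:R)) => i ia.
apply: mul_bounded_le (mul_bounded_phi i).
by rewrite ler_nat ltnW.
Qed.

(** In the Bezout relation [u] and [v] can be taken at most [b] and [a], so that
    the two multipliers, sums of at most [M] monomials, have norm at most [M]. *)
Lemma geo_pairB (M a b : nat) : (0 < a)%N -> (0 < b)%N -> coprime a b ->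
  (a <= M)%N -> (b <= M)%N ->
  exists A B : fps R, [/\ mul_bounded M%:R A, mul_bounded M%:R B &
    z * geo R a * geo R b = A * geo R b + B * geo R a].
Proof.
move=> a0 b0 /eqP ab aM bM.
case: (Bezoutl b a0) => v va; rewrite ab => /dvdnP[u uv].
have ub : (u <= b)%N by nia.
exists (phi_in R a u); exists (- (fX R * phi_in R b v)); split.
- by apply: mul_bounded_le (mul_bounded_phi_in _ _); rewrite ler_nat (leq_trans ub).
- apply: mul_boundedN; rewrite -[X in mul_bounded X]mul1r.
  apply: mul_boundedM; first exact: (mul_boundedX 1).
  apply: mul_bounded_le (mul_bounded_phi_in _ _).
  by rewrite ler_nat (leq_trans (ltnW va)).
- by rewrite (@geo_pair _ a b u v) ?mulNr // -uv.
Qed.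

Lemma sup_bounded_combine (C D : R) A B f g :
  mul_bounded C A -> mul_bounded C B -> sup_bounded D f -> sup_bounded D g ->
  sup_bounded (2 * C * D) (A * f + B * g).
Proof.
move=> CA CB Df Dg; rewrite -mulrA mulr2n mulrDl mul1r.
by apply: sup_boundedD; auto.
Qed.

(** Each use of [geo_pairB] turns a product of series into two products with
    one factor fewer and costs a factor [2 * M]; a single [geo a] has
    coefficients in {0, 1}. *)
Lemma geo2_bound (M a b : nat) : (0 < a)%N -> (0 < b)%N -> coprime a b ->
  (a <= M)%N -> (b <= M)%N -> sup_bounded (2 * M%:R) (z * geo R a * geo R b).
Proof.
move=> a0 b0 ab aM bM; have [A [B [MA MB ->]]] := geo_pairB a0 b0 ab aM bM.
by rewrite -[2 * _]mulr1; apply: sup_bounded_combine => //; exact: sup_bounded_geo.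
Qed.

Lemma geo3_bound (M a b c : nat) : (0 < a)%N -> (0 < b)%N -> (0 < c)%N ->
  coprime a b -> coprime a c -> coprime b c ->
  (a <= M)%N -> (b <= M)%N -> (c <= M)%N ->
  sup_bounded ((2 * M%:R) ^+ 2) (z ^+ 2 * geo R a * geo R b * geo R c).
Proof.
move=> a0 b0 c0 ab ac bc aM bM cM.
have [A [B [MA MB e]]] := geo_pairB a0 b0 ab aM bM.
have -> : z ^+ 2 * geo R a * geo R b * geo R c =
  A * (z * geo R b * geo R c) + B * (z * geo R a * geo R c).
  transitivity ((z * geo R a * geo R b) * z * geo R c); first by ring.
  by rewrite e; ring.
by rewrite expr2; apply: sup_bounded_combine => //; exact: geo2_bound.
Qed.

(** The only point where four pairwise coprime parts are needed: the series
    has simple poles only, and this is the quantitative form of that fact. *)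
Lemma geo4_bound (M a b c d : nat) :
  (0 < a)%N -> (0 < b)%N -> (0 < c)%N -> (0 < d)%N ->
  coprime a b -> coprime a c -> coprime a d ->
  coprime b c -> coprime b d -> coprime c d ->
  (a <= M)%N -> (b <= M)%N -> (c <= M)%N -> (d <= M)%N ->
  sup_bounded ((2 * M%:R) ^+ 3) (z ^+ 3 * geo R a * geo R b * geo R c * geo R d).
Proof.
move=> a0 b0 c0 d0 ab ac ad bc bd cd aM bM cM dM.
have [A [B [MA MB e]]] := geo_pairB a0 b0 ab aM bM.
have -> : z ^+ 3 * geo R a * geo R b * geo R c * geo R d =
  A * (z ^+ 2 * geo R b * geo R c * geo R d)
  + B * (z ^+ 2 * geo R a * geo R c * geo R d).
  transitivity ((z * geo R a * geo R b) * z ^+ 2 * geo R c * geo R d).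
    by ring.
  by rewrite e; ring.
by rewrite exprS; apply: sup_bounded_combine => //; exact: geo3_bound.
Qed.

Definition nonneg f := forall n, 0 <= f n.

Lemma nonnegM f g : nonneg f -> nonneg g -> nonneg (f * g).
Proof.
by move=> f0 g0 n; rewrite coef_fpsM; apply: sumr_ge0 => i _; rewrite mulr_ge0.
Qed.

Lemma nonneg_geo a : nonneg (geo R a).
Proof. by move=> n; rewrite /geo ler0n. Qed.

Lemma sup_bounded_mul C f g n : sup_bounded C f -> nonneg g ->
  `|(f * g) n| <= C * (geo R 1 * g) n.
Proof.
move=> Cf g0; rewrite !coef_fpsM mulr_sumr (le_trans (ler_norm_sum _ _ _)) //.
apply: ler_sum => i _; rewrite normrM (ger0_norm (g0 _)) /geo dvd1n mul1r.
by rewrite ler_wpM2r.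
Qed.

End Bounds.

(** * The generating function of the partition counts *)

Section GeneratingFunction.
Variable R : comNzRingType.

Definition eq_upto n (f g : fps R) := forall m, (m <= n)%N -> f m = g m.

Lemma eq_uptoM n f f' g g' :
  eq_upto n f f' -> eq_upto n g g' -> eq_upto n (f * g) (f' * g').
Proof.
move=> ff' gg' m mn; rewrite !coef_fpsM; apply: eq_bigr => i _.
by rewrite ff' ?gg' ?(leq_trans (leq_subr _ _)) // (leq_trans _ mn) // -ltnS.
Qed.

(** Up to degree [n] the geometric series may be cut after [n.+1] terms, which
    matches the encoding of multiplicities as elements of ['I_n.+1]. *)
Lemma geo_trunc n b : (0 < b)%N ->
  eq_upto n (geo R b) (\sum_(j < n.+1) fX R ^+ (j * b)).
Proof.
move=> b0 m mn; rewrite coef_fps_sum /geo.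
under eq_bigr => j _ do rewrite coef_fXn.
case: (boolP (b %| m)%N) => [/dvdnP[q mq]|bm].
  have qn : (q < n.+1)%N by nia.
  rewrite (bigD1 (Ordinal qn)) //= mq eqxx big1 ?addr0 // => j jq.
  rewrite eqn_pmul2r //; case: eqP => // e; case/eqP: jq.
  by apply: val_inj.
rewrite big1 // => j _; case: eqP => // e; case/negP: bm.
by rewrite e dvdn_mull.
Qed.

Lemma pA_coef (a : nat -> nat) n k :
  (forall i, (1 <= i)%N -> (0 < a i)%N) ->
  (pA a n k)%:R = (\prod_(i < k) geo R (a i.+1)) n.
Proof.
move=> a0.
have -> : (\prod_(i < k) geo R (a i.+1)) n =
    (\prod_(i < k) \sum_(j < n.+1) fX R ^+ (j * a i.+1)) n.
  have : eq_upto n (\prod_(i < k) geo R (a i.+1))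
    (\prod_(i < k) \sum_(j < n.+1) fX R ^+ (j * a i.+1)).
    apply: (big_ind2 (fun f g => eq_upto n f g)) => //.
    - by move=> f f' g g'; apply: eq_uptoM.
    - by move=> i _; apply: geo_trunc; exact: a0.
  exact.
rewrite bigA_distr_bigA coef_fps_sum.
under eq_bigr => f _ do rewrite prodrXr coef_fXn eq_sym.
rewrite -natr_sum /pA /restricted_partitions -sum1dep_card big_mkcond /=.
by congr (_%:R); apply: eq_bigr => f _; case: eqP.
Qed.

End GeneratingFunction.

(** * Counting lattice points in a simplex *)

Section Counting.
Variable R : realFieldType.

(** The next two inequalities bound the increment of x^(d+1) over [x, x + b] by
    its derivative at the endpoints; they drive the induction that compares
    lattice points with volumes. *)
Lemma bernoulli_lower d (x b : R) : 0 <= x -> 0 <= b ->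
  x ^+ d.+1 + d.+1%:R * b * x ^+ d <= (x + b) ^+ d.+1.
Proof.
move=> x0 b0; elim: d => [|d IH]; first by rewrite !expr1 expr0; lra.
rewrite [leRHS]exprS.
apply: le_trans (ler_wpM2l (addr_ge0 x0 b0) IH).
rewrite -[d.+2%:R]natr1 [x ^+ d.+2]exprS [x ^+ d.+1]exprS.
have e0 : 0 <= x ^+ d by rewrite exprn_ge0.
have : 0 <= d.+1%:R * b * b * x ^+ d by rewrite !mulr_ge0.
move: (x ^+ d) (d.+1%:R : R) => y m; lra.
Qed.

Lemma bernoulli_upper d (x b : R) : 0 <= x -> 0 <= b ->
  (x + b) ^+ d.+1 <= x ^+ d.+1 + d.+1%:R * b * (x + b) ^+ d.
Proof.
move=> x0 b0; elim: d => [|d IH]; first by rewrite !expr1 expr0; lra.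
rewrite exprS mulrDl.
have := ler_wpM2l x0 IH.
rewrite -[d.+2%:R]natr1 [x ^+ d.+2]exprS [(x + b) ^+ d.+1]exprS.
have e0 : 0 <= (x + b) ^+ d by rewrite exprn_ge0 // addr_ge0.
have : 0 <= d.+1%:R * b * b * (x + b) ^+ d by rewrite !mulr_ge0.
move: ((x + b) ^+ d) (x ^+ d.+1) (d.+1%:R : R) => y w m; lra.
Qed.

(** The factor [geo R 1] is a slack variable: the coefficient of X^n counts the
    partitions of the integers at most [n] into parts in [s]. *)
Definition bounded_partitions (s : seq nat) : fps R :=
  geo R 1 * \prod_(b <- s) geo R b.

(** Either the part [b] does not occur, or one copy of it can be removed. *)
Lemma bounded_partitions_cons b s n : (0 < b)%N ->
  bounded_partitions (b :: s) n = bounded_partitions s n +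
    (if (b <= n)%N then bounded_partitions (b :: s) (n - b)%N else 0).
Proof.
move=> b0; rewrite -coef_fXnM -coef_fpsD.
suff {1}-> : bounded_partitions (b :: s) = bounded_partitions s
    + fX R ^+ b * bounded_partitions (b :: s) :> fps R by [].
rewrite /bounded_partitions big_cons; set P := \prod_(_ <- s) _.
transitivity (geo R 1 * P * ((1 - fX R ^+ b) * geo R b)
  + fX R ^+ b * (geo R 1 * (geo R b * P))); first by ring.
by rewrite geoM // mulr1.
Qed.

(** The simplex sum b_i x_i <= n has volume n^d / (d! prod b_i).  The unit cubes
    attached to its integer points cover it and are contained in the simplex of
    size n + sum b_i, whence the two bounds.  The proof is by induction along
    [bounded_partitions_cons], in the real inequalities above. *)
Lemma bounded_partitions_bounds s n : all (leq 1) s ->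
  n%:R ^+ size s <=
    ((size s)`! * \prod_(b <- s) b)%N%:R * bounded_partitions s n
    <= (n + \sum_(b <- s) b)%N%:R ^+ size s.
Proof.
elim: s n => [|b s IHs] n /=.
  rewrite /bounded_partitions !big_nil !expr0 mulr1 mul1r /geo dvd1n.
  by rewrite lexx.
move=> /andP[b0 s0]; elim/ltn_ind: n => n IHn.
rewrite (bounded_partitions_cons s n b0) !big_cons factS.
have /andP[L1 U1] := IHs n s0.
set d := size s in L1 U1 IHn *; set sg := (\sum_(b <- s) b)%N in L1 U1 *.
set Pi := (\prod_(b <- s) b)%N in L1 U1 *.
have eC : (d.+1 * d`! * (b * Pi))%N%:R = d.+1%:R * b%:R * (d`! * Pi)%N%:R :> R.
  by rewrite !natrM; ring.
have eL : (d.+1 * d`! * (b * Pi))%N%:R * bounded_partitions s n =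
    d.+1%:R * b%:R * ((d`! * Pi)%N%:R * bounded_partitions s n).
  by rewrite eC mulrA.
have bR : 0 <= b%:R :> R by [].
have db0 : 0 <= d.+1%:R * b%:R :> R by rewrite mulr_ge0.
rewrite mulrDr eL.
have L2 := ler_wpM2l db0 L1; have U2 := ler_wpM2l db0 U1.
have [bn|nb] := leqP b n.
  have nbn : (n - b < n)%N by rewrite ltn_subrL b0 (leq_trans b0).
  have := IHn _ nbn; rewrite !big_cons factS -/d -/sg -/Pi => /andP[L3 U3].
  apply/andP; split.
    apply: le_trans (lerD L2 L3).
    have := @bernoulli_upper d (n - b)%:R b%:R (ler0n _ _) bR.
    by rewrite -natrD subnK // addrC.
  apply: le_trans (lerD U2 U3) _.
  have -> : (n - b + (b + sg) = n + sg)%N by lia.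
  have := @bernoulli_lower d (n + sg)%:R b%:R (ler0n _ _) bR.
  have -> : (n + (b + sg) = n + sg + b)%N by lia.
  by rewrite -natrD addrC.
rewrite mulr0 addr0; apply/andP; split.
  apply: le_trans L2; rewrite exprS ler_wpM2r ?exprn_ge0 //.
  by rewrite -natrM ler_nat; nia.
apply: le_trans U2 _.
have := @bernoulli_lower d (n + sg)%:R b%:R (ler0n _ _) bR.
have -> : (n + (b + sg) = n + sg + b)%N by lia.
rewrite -natrD => h; apply: le_trans h.
by rewrite lerDr exprn_ge0.
Qed.

End Counting.

(** * Main term and error term *)

Section MainTerm.
Variable R : realFieldType.
Local Notation z := (1 - fX R).

(** By [geo_triple] the difference is a polynomial times the series of
    [geo4_bound] times [r], and [r] has nonnegative coefficients.  The error
    involves [geo R 1 * r] without the factor [geo R d]: the coefficients of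
    that series grow one degree more slowly than the main term. *)
Lemma approx_bounded_partitions (M a b c d : nat) (r : fps R) m :
  (0 < a)%N -> (0 < b)%N -> (0 < c)%N -> (0 < d)%N ->
  coprime a b -> coprime a c -> coprime a d ->
  coprime b c -> coprime b d -> coprime c d ->
  (a <= M)%N -> (b <= M)%N -> (c <= M)%N -> (d <= M)%N -> nonneg r ->
  `|(a * b * c)%N%:R * (z ^+ 2 * geo R a * geo R b * geo R c * geo R d * r) m
    - (geo R 1 * geo R d * r) m|
  <= (a * b * c * (a + b + c))%N%:R * (2 * M%:R) ^+ 3 * (geo R 1 * r) m.
Proof.
move=> a0 b0 c0 d0 ab ac ad bc bd cd aM bM cM dM r0.
have G := @geo4_bound R M a b c d a0 b0 c0 d0 ab ac ad bc bd cd aM bM cM dM.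
have T := geo_triple R a0 b0 c0.
set V := (psi R a * b%:R * c%:R + phi R a * psi R b * c%:R
  + phi R a * phi R b * psi R c) in T.
have VB : mul_bounded (a * b * c * (a + b + c))%N%:R V.
  have -> : (a * b * c * (a + b + c))%N%:R = a%:R ^+ 2 * b%:R * c%:R
      + a%:R * b%:R ^+ 2 * c%:R + a%:R * b%:R * c%:R ^+ 2 :> R.
    by rewrite !natrM !natrD; ring.
  by apply: mul_boundedD; first apply: mul_boundedD; (apply: mul_boundedM; first apply: mul_boundedM);
    first [exact: mul_bounded_psi | exact: mul_bounded_phi | exact: mul_bounded_nat].
apply: le_trans (sup_bounded_mul m (VB _ _ G) r0).
suff -> : (a * b * c)%N%:R * (z ^+ 2 * geo R a * geo R b * geo R c * geo R d * r) m
    - (geo R 1 * geo R d * r) m =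
  (V * (z ^+ 3 * geo R a * geo R b * geo R c * geo R d) * r) m by [].
rewrite mulr_natl -coef_fpsMn -coef_fpsN -coef_fpsD -mulr_natl.
suff -> : (a * b * c)%:R * (z ^+ 2 * geo R a * geo R b * geo R c * geo R d * r) =
    geo R 1 * geo R d * r
    + V * (z ^+ 3 * geo R a * geo R b * geo R c * geo R d) * r :> fps R.
  by rewrite addrC addKr.
transitivity ((a * b * c)%:R * (z ^+ 2 * geo R a * geo R b * geo R c)
   * geo R d * r); first by ring.
by rewrite T; ring.
Qed.

End MainTerm.

Section CoefBounds.
Variable R : realFieldType.
Local Notation z := (1 - fX R).

Lemma nonneg_prod_geo t : nonneg (\prod_(b <- t) geo R b).
Proof.
apply: (big_ind (@nonneg R)) => [n|f g|b _].
- by rewrite coef_fps1.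
- exact: nonnegM.
- exact: nonneg_geo.
Qed.

(** Main term and error term are both counted by [bounded_partitions_bounds];
    multiplication by [(e.+1)`!] and by all the parts clears the denominators.
    The error term lacks the part [d], which explains the factors [d] and [e.+1]
    that it carries after this normalisation. *)
Lemma coef_bounds (a b c d : nat) (t : seq nat) m (Y : R) :
  (0 < a)%N -> (0 < b)%N -> (0 < c)%N -> (0 < d)%N ->
  coprime a b -> coprime a c -> coprime a d ->
  coprime b c -> coprime b d -> coprime c d ->
  (a <= d)%N -> (b <= d)%N -> (c <= d)%N -> all (leq 1) t ->
  (m + (d + \sum_(b <- t) b))%N%:R <= Y ->
  let e := size t in
  let eta := (a * b * c * (a + b + c) * (2 * d) ^ 3 * d)%N%:R : R in
  let Q := ((e.+1)`! * (d * \prod_(b <- t) b) * (a * b * c))%N%:R *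
    (z ^+ 2 * geo R a * geo R b * geo R c * geo R d * \prod_(b <- t) geo R b) m in
  m%:R ^+ e.+1 - eta * e.+1%:R * Y ^+ e <= Q /\
  Q <= Y ^+ e.+1 + eta * e.+1%:R * Y ^+ e.
Proof.
move=> a0 b0 c0 d0 ab ac ad bc bd cd aM bM cM t1 mY e eta Q.
have := approx_bounded_partitions m a0 b0 c0 d0 ab ac ad bc bd cd aM bM cM (leqnn d)
  (nonneg_prod_geo t).
have dt1 : all (leq 1) (d :: t) by rewrite /= d0.
have /andP[] := @bounded_partitions_bounds R (d :: t) m dt1.
have /andP[_] := @bounded_partitions_bounds R t m t1.
rewrite /bounded_partitions !big_cons -/e /=.
rewrite [geo R 1 * (geo R d * _)]mulrA.
rewrite /Q; set q := (z ^+ 2 * _ * _ * _ * _ * _) m.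
set S := (geo R 1 * _ * _) m; set T := (geo R 1 * _) m.
set P := (\prod_(b <- t) b)%N.
move=> HT LS US.
have Y0 : 0 <= Y := le_trans (ler0n _ _) mY.
have YT : (m + \sum_(b <- t) b)%N%:R ^+ e <= Y ^+ e.
  rewrite lerXn2r ?nnegrE ?ler0n // (le_trans _ mY) //.
  by rewrite ler_nat leq_add2l leq_addl.
have YS : (m + (d + \sum_(b <- t) b))%N%:R ^+ e.+1 <= Y ^+ e.+1.
  by rewrite lerXn2r ?nnegrE ?ler0n.
have {YT}HT := le_trans HT YT; have {YS}US := le_trans US YS.
set w : R := ((e.+1)`! * (d * P))%N%:R in LS US.
have w0 : 0 <= w by [].
rewrite ler_distl => /andP[ML MU].
have := ler_wpM2l w0 ML; have := ler_wpM2l w0 MU.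
have -> : w * ((a * b * c)%N%:R * q) = ((e.+1)`! * (d * P) * (a * b * c))%N%:R * q.
  by rewrite mulrA /w -natrM.
rewrite mulrBr mulrDr.
set E := w * (_ * T).
have EE : E <= eta * e.+1%:R * Y ^+ e.
  have -> : E = eta * e.+1%:R * ((e`! * P)%N%:R * T).
    by rewrite /E /w /eta factS !natrM; ring.
  by apply: ler_wpM2l HT; rewrite mulr_ge0.
move: EE LS US; set x := _%:R * q; set y := w * S.
move=> EE LS US MU' ML'; split.
  by apply: le_trans ML'; apply: lerB.
by apply: le_trans MU' _; apply: lerD.
Qed.

End CoefBounds.

(** * The inequality between real numbers *)

Section FinalInequality.
Variable R : realFieldType.

(** With j = k - 1 the leading coefficients leave the gap
    j^2 - (j (j - 1) + 1) = j - 1, and relative errors th = 1 / (10 j) in the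
    factors consume less than 0.4 j + 1 of it. *)
Lemma leading_term_gap (j th : R) : 4 <= j -> 10 * j * th = 1 ->
  j * (j - 1) * (1 + th) ^+ 2 + (1 + th) ^+ 4 < j ^+ 2 * (1 - th) ^+ 2.
Proof.
move=> j4 jth.
have jth' : j * th = 10^-1 by lra.
have th0 : 0 < th by nra.
have th1 : th <= 40^-1 by nra.
have -> : j ^+ 2 * (1 - th) ^+ 2 = j ^+ 2 - 2 * j * (j * th) + (j * th) ^+ 2.
  by ring.
have -> : j * (j - 1) * (1 + th) ^+ 2 =
   j ^+ 2 + 2 * j * (j * th) + (j * th) ^+ 2 - j - 2 * (j * th) - (j * th) * th.
  by ring.
have t4 : (1 + th) ^+ 4 <= 2.
  have -> : (1 + th) ^+ 4 = ((1 + th) ^+ 2) ^+ 2 by rewrite -exprM.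
  have : (1 + th) ^+ 2 <= 11/10 by nra.
  have : 0 <= (1 + th) ^+ 2 by rewrite sqr_ge0.
  move: ((1 + th) ^+ 2) => u; nra.
by rewrite jth'; lra.
Qed.

(** Here [K.+2] is k - 1, and [d], [D], [p0], [p1] are the first difference, the
    second difference and two neighbouring values, normalised so that their
    leading coefficients are 1.  The size condition on [n] makes every relative
    error at most th = 1 / (10 (k - 1)), both those coming from [eta] and those
    coming from the shift from [n] to [n + s]. *)
Lemma difference_gap K (n s eta d D p0 p1 : R) :
  (2 <= K)%N -> 0 < n -> 0 <= s -> 0 <= eta ->
  10 * K.+2%:R ^+ 2 * (eta + s) <= n ->
  n ^+ K.+1 - eta * K.+1%:R * (n + s) ^+ K <= d ->
  D <= (n + s) ^+ K + eta * K%:R * (n + s) ^+ K.-1 ->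
  0 <= p0 -> p0 <= (n + s) ^+ K.+2 + eta * K.+2%:R * (n + s) ^+ K.+1 ->
  0 <= p1 -> p1 <= (n + s) ^+ K.+2 + eta * K.+2%:R * (n + s) ^+ K.+1 ->
  K.+2%:R * K.+1%:R * D * p0 + p0 * p1 / n ^+ 2 < K.+2%:R ^+ 2 * d ^+ 2.
Proof.
move=> K2 n0 s0 eta0 big dL DU p00 p0U p10 p1U.
set Y := n + s in dL DU p0U p1U.
have Y0 : 0 < Y by rewrite ltr_wpDr.
have nY : n <= Y by rewrite lerDl.
set j : R := K.+2%:R in big p0U p1U *.
have j4 : 4 <= j by rewrite /j ler_nat.
have ej : K.+1%:R = j - 1 by rewrite /j -[K.+2%:R]natr1 addrK.
have eK : K%:R = j - 2 by rewrite -[LHS](addrK 1) natr1 ej; ring.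
set th := (10 * j)^-1.
have jth : 10 * j * th = 1 by rewrite mulfV //; lra.
clearbody th.
have jth' : j * th = 10^-1 by lra.
have th0 : 0 < th by nra.
have thn : j * (eta + s) <= th * n.
  have -> : j * (eta + s) = th * (10 * j ^+ 2 * (eta + s)).
    by rewrite -[LHS]mul1r -[X in X * _ = _]jth; ring.
  by rewrite ler_wpM2l // ltW.
have mrg := leading_term_gap j4 jth.
have js0 : 0 <= j * s by rewrite mulr_ge0 //; lra.
have je0 : 0 <= j * eta by rewrite mulr_ge0 //; lra.
have thY : th * n <= th * Y by rewrite ler_wpM2l // ltW.
have dL' : (1 - th) * Y ^+ K.+1 <= d.
  apply: le_trans dL.
  have := @bernoulli_upper R K n s (ltW n0) s0; rewrite -/Y ej.
  have : 0 <= (th * Y - (j - 1) * (eta + s)) * Y ^+ K.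
    by rewrite mulr_ge0 ?exprn_ge0 ?(ltW Y0) //; lra.
  rewrite [Y ^+ K.+1]exprS; move: (Y ^+ K) (n ^+ K.+1) => u v; lra.
have DU' : D <= (1 + th) * Y ^+ K.
  apply: le_trans DU _; rewrite eK.
  have -> : Y ^+ K = Y * Y ^+ K.-1 by rewrite -exprS prednK // ltnW.
  have : 0 <= (th * Y - (j - 2) * eta) * Y ^+ K.-1.
    by rewrite mulr_ge0 ?exprn_ge0 ?(ltW Y0) //; lra.
  by move: (Y ^+ K.-1) => u; lra.
have pU p : p <= Y ^+ K.+2 + eta * j * Y ^+ K.+1 -> p <= (1 + th) * Y ^+ K.+2.
  move=> h; apply: le_trans h _.
  have : 0 <= (th * Y - j * eta) * Y ^+ K.+1.
    by rewrite mulr_ge0 ?exprn_ge0 ?(ltW Y0) //; lra.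
  rewrite [Y ^+ K.+2]exprS; move: (Y ^+ K.+1) => u; lra.
have {}p0U := pU _ p0U; have {}p1U := pU _ p1U.
have Yn : Y <= (1 + th) * n.
  have : 0 <= (j - 1) * s by rewrite mulr_ge0 //; lra.
  by rewrite /Y; lra.
have th1 : th < 1.
  have : 0 <= (j - 4) * th by rewrite mulr_ge0 ?(ltW th0) // subr_ge0.
  by lra.
set U := Y ^+ K.+1.
have U0 : 0 < U by rewrite exprn_gt0.
have t1 : K.+1%:R * D * p0 <= (j - 1) * ((1 + th) ^+ 2 * U ^+ 2).
  rewrite ej -mulrA ler_wpM2l //; first by lra.
  have -> : (1 + th) ^+ 2 * U ^+ 2 = ((1 + th) * Y ^+ K) * ((1 + th) * Y ^+ K.+2).
    by rewrite /U !exprS; ring.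
  have tK : 0 <= (1 + th) * Y ^+ K by rewrite mulr_ge0 ?exprn_ge0 ?(ltW Y0) //; lra.
  by apply: le_trans (ler_wpM2r p00 DU') _; rewrite ler_wpM2l.
have t2 : p0 * p1 / n ^+ 2 <= (1 + th) ^+ 4 * U ^+ 2.
  rewrite ler_pdivrMr ?exprn_gt0 //.
  apply: le_trans (ler_pM p00 p10 p0U p1U) _.
  have -> : (1 + th) * Y ^+ K.+2 * ((1 + th) * Y ^+ K.+2) =
    (1 + th) ^+ 2 * U ^+ 2 * Y ^+ 2 by rewrite /U !exprS; ring.
  have -> : (1 + th) ^+ 4 * U ^+ 2 * n ^+ 2 =
    (1 + th) ^+ 2 * U ^+ 2 * ((1 + th) * n) ^+ 2 by ring.
  apply: ler_wpM2l; first by rewrite mulr_ge0 ?sqr_ge0.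
  by rewrite lerXn2r // nnegrE ?(ltW Y0) // (le_trans _ Yn) // ltW.
have t3 : (1 - th) ^+ 2 * U ^+ 2 <= d ^+ 2.
  rewrite -exprMn lerXn2r // nnegrE.
    by rewrite mulr_ge0 ?(ltW U0) //; lra.
  by apply: le_trans dL'; rewrite mulr_ge0 ?(ltW U0) //; lra.
have j0 : 0 <= j by lra.
have := ler_wpM2l j0 t1; have := ler_wpM2l (sqr_ge0 j) t3.
have := mrg; rewrite -(ltr_pM2r (exprn_gt0 2 U0)).
rewrite -!mulrA; lra.
Qed.

End FinalInequality.

(** * Log-concavity *)

(** The error constant is at most 24 N A^5 with N = a1 a2 a3, and the shift is
    at most (l + 2) A.  The bound 2 k^2 (k-1)! N^3 A^(k+3) with k = l + 4
    exceeds the sum by a wide margin, half of it being used for each. *)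
Lemma explicit_bound_suffices (l a1 a2 a3 a4 A sg : nat) :
  (0 < l)%N -> (0 < a1)%N -> (a1 < a2)%N -> (a2 < a3)%N -> (a3 < a4)%N ->
  (a4 < A)%N -> (sg <= l * A)%N ->
  (10 * l.+3 ^ 2 * (a1 * a2 * a3 * (a1 + a2 + a3) * (2 * a4) ^ 3 * a4
      + (a4 + sg + 3)) <=
   2 * l.+4 ^ 2 * (l.+3)`! * (a1 * a2 * a3) ^ 3 * A ^ (l.+4 + 3))%N.
Proof.
move=> l0 a10 a12 a23 a34 a4A sgA.
have A5 : (5 <= A)%N by lia.
have N0 : (0 < a1 * a2 * a3)%N by rewrite !muln_gt0; lia.
set N := (a1 * a2 * a3)%N in N0 *.
have eta_le : (N * (a1 + a2 + a3) * (2 * a4) ^ 3 * a4 <= 24 * N * A ^ 5)%N.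
  (* a1 + a2 + a3 <= 3 A and (2 a4)^3 a4 <= 8 A^4 *)
  have -> : (24 * N * A ^ 5 = N * (3 * A) * (2 * A) ^ 3 * A)%N by ring.
  have a4A' := ltnW a4A.
  apply: leq_mul => //; apply: leq_mul; last by rewrite leq_exp2r // leq_mul2l.
  by rewrite leq_mul2l; apply/orP; right; lia.
have s_le : (a4 + sg + 3 <= l.+2 * A)%N by nia.
have f24 : (24 <= (l.+3)`!)%N by apply: (@leq_fact 4); lia.
have fl : (l.+2 <= (l.+3)`!)%N.
  by rewrite factS; apply: leq_trans (leq_pmulr _ (fact_gt0 _)).
have AA : (A ^ 8 <= A ^ (l.+4 + 3))%N by rewrite leq_pexp2l //; lia.
have A3 : (10 <= A ^ 3)%N by apply: leq_trans (_ : 5 ^ 3 <= _)%N; rewrite ?leq_exp2r.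
have A7 : (10 <= A ^ 7)%N.
  by apply: leq_trans A3 _; rewrite leq_pexp2l //; lia.
have NN : (N <= N ^ 3)%N by rewrite -[X in (X <= _)%N]expn1 leq_pexp2l.
have l34 : (l.+3 ^ 2 <= l.+4 ^ 2)%N by rewrite leq_exp2r.
set f := (l.+3)`! in f24 fl *.
have p1 : (10 * l.+3 ^ 2 * (24 * N * A ^ 5) <=
    l.+4 ^ 2 * f * N ^ 3 * A ^ (l.+4 + 3))%N.
  apply: (@leq_trans (l.+4 ^ 2 * f * N ^ 3 * A ^ 8)).
    2: by rewrite leq_mul2l AA orbT.
  have -> : (10 * l.+3 ^ 2 * (24 * N * A ^ 5) =
    l.+3 ^ 2 * 24 * N * (10 * A ^ 5))%N by ring.
  have -> : (A ^ 8 = A ^ 3 * A ^ 5)%N by rewrite -expnD.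
  by do ?[apply: leq_mul => //].
have p2 : (10 * l.+3 ^ 2 * (l.+2 * A) <=
    l.+4 ^ 2 * f * N ^ 3 * A ^ (l.+4 + 3))%N.
  apply: (@leq_trans (l.+4 ^ 2 * f * N ^ 3 * A ^ 8)).
    2: by rewrite leq_mul2l AA orbT.
  have -> : (10 * l.+3 ^ 2 * (l.+2 * A) =
    l.+3 ^ 2 * l.+2 * 1 * (10 * A))%N by ring.
  rewrite [(A ^ 8)%N]expnSr.
  have N3 : (1 <= N ^ 3)%N by rewrite expn_gt0 N0.
  by do ?[apply: leq_mul => //].
have h1 := leq_mul (leqnn (10 * l.+3 ^ 2)) eta_le.
have h2 := leq_mul (leqnn (10 * l.+3 ^ 2)) s_le.
rewrite mulnDr.
apply: leq_trans (leq_add (leq_trans h1 p1) (leq_trans h2 p2)) _.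
by rewrite addnn -mul2n !mulnA.
Qed.

Section Main.
Variable R : realFieldType.
Local Notation z := (1 - fX R).

Lemma coef_z (f : fps R) n : (z * f) n.+1 = f n.+1 - f n.
Proof. by rewrite mulrBl mul1r coef_fpsD coef_fpsN coef_fXM. Qed.

(** The parts a_5, ..., a_(l+4). *)
Definition parts_after4 (a : nat -> nat) l := [seq a i.+1 | i <- iota 4 l].

Lemma prod_geo_split (a : nat -> nat) l :
  \prod_(i < l.+4) geo R (a i.+1) =
  geo R (a 1%N) * geo R (a 2%N) * geo R (a 3%N) * geo R (a 4%N) *
    \prod_(b <- parts_after4 a l) geo R b.
Proof.
rewrite -(big_mkord xpredT (fun i => geo R (a i.+1))) /index_iota subn0 /=.
by rewrite !big_cons /parts_after4 big_map !mulrA.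
Qed.

Lemma sum_nseq_cat i s : (\sum_(b <- nseq i 1 ++ s) b = i + \sum_(b <- s) b)%N.
Proof. by rewrite big_cat big_nseq iter_addn_0 /= mul1n. Qed.

Lemma prod_nseq_cat i s : (\prod_(b <- nseq i 1 ++ s) b = \prod_(b <- s) b)%N.
Proof. by rewrite big_cat big_nseq iter_muln_1 exp1n /= mul1n. Qed.

(** The three series F, z F and z^2 F are the products of z^2 times the first
    four geometric series, the tail a_5, ..., a_k, and respectively two, one and
    zero additional parts equal to 1. *)
Lemma pA_strong_log_concave (a : nat -> nat) l n :
  (0 < l)%N -> (0 < n)%N ->
  (forall i : nat, (1 <= i)%N -> (0 < a i)%N) ->
  (forall i j : nat, (1 <= i)%N -> (i < j)%N -> (a i < a j)%N) ->
  (forall i j : nat,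
       (1 <= i)%N -> (i < j)%N -> (j <= 4)%N -> gcdn (a i) (a j) = 1%N) ->
  (10 * l.+3 ^ 2 *
    (a 1 * a 2 * a 3 * (a 1 + a 2 + a 3) * (2 * a 4) ^ 3 * a 4
     + (a 4 + \sum_(b <- parts_after4 a l) b + 3)) <= n)%N ->
  (1 + 1 / n%:R ^+ 2) * (pA a n.+1 l.+4)%:R * (pA a n.-1 l.+4)%:R
    < (pA a n l.+4)%:R ^+ 2 :> R.
Proof.
move=> l0 n0 a0 a_incr a_cop big.
have cop i j : (1 <= i)%N -> (i < j)%N -> (j <= 4)%N -> coprime (a i) (a j).
  by move=> i1 ij j4; apply/eqP; exact: a_cop.
have le4 i : (1 <= i)%N -> (i < 4)%N -> (a i <= a 4)%N.
  by move=> i1 i4; apply/ltnW/a_incr.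
rewrite !(pA_coef R _ _ a0) prod_geo_split.
set G := (geo R (a 1%N) * geo R (a 2%N) * geo R (a 3%N) * geo R (a 4%N)).
set s := parts_after4 a l in big *.
have s1 : all (leq 1) s.
  by apply/allP => x /mapP[i _ ->]; exact: a0.
have ss : size s = l by rewrite size_map size_iota.
set F := G * _.
pose sg := (a 4 + \sum_(b <- s) b + 3)%N.
pose eta := (a 1 * a 2 * a 3 * (a 1 + a 2 + a 3) * (2 * a 4) ^ 3 * a 4)%N.
pose w i := (((l + i).+1)`! * (a 4 * \prod_(b <- s) b) * (a 1 * a 2 * a 3))%N.
pose q i : fps R := z ^+ 2 * geo R (a 1%N) * geo R (a 2%N) * geo R (a 3%N)
     * geo R (a 4%N) * \prod_(b <- nseq i 1%N ++ s) geo R b.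
(* i is the number of additional parts equal to 1; all the bounds are taken
   at the common abscissa n + sg, which dominates every shifted argument. *)
have key i m : (m + i <= n + 3)%N ->
    let Y : R := n%:R + sg%:R in
    m%:R ^+ (l + i).+1 - eta%:R * (l + i).+1%:R * Y ^+ (l + i)
      <= (w i)%:R * q i m
    /\ (w i)%:R * q i m <= Y ^+ (l + i).+1 + eta%:R * (l + i).+1%:R * Y ^+ (l + i).
  move=> mi Y.
  have t1 : all (leq 1) (nseq i 1%N ++ s) by rewrite all_cat all_nseq orbT.
  have := @coef_bounds R (a 1%N) (a 2%N) (a 3%N) (a 4%N) (nseq i 1%N ++ s) m Y
    (a0 1%N isT) (a0 2%N isT) (a0 3%N isT) (a0 4%N isT)
    (cop 1%N 2%N isT isT isT) (cop 1%N 3%N isT isT isT) (cop 1%N 4%N isT isT isT)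
    (cop 2%N 3%N isT isT isT) (cop 2%N 4%N isT isT isT) (cop 3%N 4%N isT isT isT)
    (le4 1%N isT isT) (le4 2%N isT isT) (le4 3%N isT isT) t1.
  rewrite sum_nseq_cat prod_nseq_cat size_cat size_nseq ss [(i + l)%N]addnC.
  by apply; rewrite /Y -natrD ler_nat /sg; lia.
have z1 := zgeo1 R.
have q2 : q 2%N = F.
  rewrite /q /= !big_cons /F /G; set S := \prod_(_ <- s) _.
  transitivity ((z * geo R 1) ^+ 2 * G * S); first by rewrite /G; ring.
  by rewrite z1 expr1n mul1r.
have q1 : q 1%N = z * F.
  rewrite /q /= !big_cons /F /G; set S := \prod_(_ <- s) _.
  transitivity (z * (z * geo R 1) * G * S); first by rewrite /G; ring.
  by rewrite z1 mulr1 -mulrA.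
have q0 : q 0%N = z * (z * F).
  by rewrite /q /= /F /G; ring.
case: n n0 big key => // n _ big key /=.
have /= [k1 _] := key 1%N n.+1 ltac:(lia).
have /= [_ k0] := key 0%N n.+2 ltac:(lia).
have /= [_ k2] := key 2%N n.+2 ltac:(lia).
have /= [_ k2'] := key 2%N n ltac:(lia).
have F0 : nonneg F.
  apply: nonnegM (nonneg_prod_geo R s).
  by do 3![apply: nonnegM; last exact: nonneg_geo]; exact: nonneg_geo.
rewrite q1 coef_z in k1; rewrite q0 !coef_z in k0; rewrite q2 in k2 k2'.
rewrite !addn0 in k0; rewrite !addn1 in k1; rewrite !addn2 in k2 k2'.
have nR : 0 < n.+1%:R :> R by [].
have bigR : 10 * (l.+1).+2%:R ^+ 2 * (eta%:R + sg%:R) <= n.+1%:R :> R.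
  by rewrite -natrD -natrX -!natrM ler_nat.
have := @difference_gap R l.+1 n.+1%:R sg%:R eta%:R _ _ _ _ l0 nR
  (ler0n _ _) (ler0n _ _)
  bigR k1 k0 (mulr_ge0 (ler0n _ _) (F0 _)) k2' (mulr_ge0 (ler0n _ _) (F0 _)) k2.
(* The three normalising factors differ only by the factorials, and their
   ratios are the coefficients that appear in the inequality just obtained. *)
have w1E : (w 1%N)%:R = l.+2%:R * (w 0%N)%:R :> R.
  by rewrite /w addn0 addn1 -natrM [(l.+2)`!]factS !mulnA.
have w2E : (w 2%N)%:R = l.+3%:R * (w 1%N)%:R :> R.
  by rewrite /w addn1 addn2 -natrM [(l.+3)`!]factS !mulnA.
have w20 : 0 < (w 2%N)%:R :> R.
  rewrite ltr0n /w !muln_gt0 fact_gt0 !a0 // !andbT /=.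
  by rewrite big_seq; apply: prodn_cond_gt0 => b /(allP s1).
move: (F n.+2) (F n.+1) (F n) => p1 p p0.
set W := (w 2%N)%:R in w20 w2E *.
have -> : l.+3%:R ^+ 2 * ((w 1%N)%:R * (p - p0)) ^+ 2 = W ^+ 2 * (p - p0) ^+ 2.
  by rewrite w2E; ring.
have -> : l.+3%:R * l.+2%:R * ((w 0%N)%:R * (p1 - p - (p - p0))) * (W * p0)
  + W * p0 * (W * p1) / n.+1%:R ^+ 2 =
  W ^+ 2 * ((p1 - p - (p - p0)) * p0 + p1 * p0 / n.+1%:R ^+ 2).
  by rewrite w2E w1E; ring.
rewrite ltr_pM2l ?exprn_gt0 // div1r.
by move: (_ ^-1) => v; lra.
Qed.

End Main.

Theorem theorem4p7 (R : realType) (a : nat -> nat) (k : nat)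
    (a_gt0 : forall i : nat, (1 <= i)%N -> (0 < a i)%N)
    (a_incr : forall i j : nat, (1 <= i)%N -> (i < j)%N -> (a i < a j)%N)
    (a_coprime : forall i j : nat,
       (1 <= i)%N -> (i < j)%N -> (j <= 4)%N -> gcdn (a i) (a j) = 1%N)
    (k_gt4 : (4 < k)%N) :
  let bound : R :=
    2 * k%:R ^+ 2 * (k.-1)`!%:R * ((a 1%N)%:R * (a 2%N)%:R * (a 3%N)%:R) ^+ 3
      * (a k)%:R ^+ (k + 3) * expR (1 / (a k)%:R) in
  (forall n : nat, bound < n%:R ->
     (pA a n k)%:R ^+ 2
       > (1 + 1 / n%:R ^+ 2) * (pA a n.+1 k)%:R * (pA a n.-1 k)%:R :> R)
  /\ (forall n : nat, bound < n%:R -> log_concave_at (fun m => pA a m k) n).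
Proof.
move=> bound.
have main (n : nat) : bound < n%:R ->
     (pA a n k)%:R ^+ 2
       > (1 + 1 / n%:R ^+ 2) * (pA a n.+1 k)%:R * (pA a n.-1 k)%:R :> R.
  case: k k_gt4 @bound => [|[|[|[|l]]]] // l0 bound bn.
  have sg_le : (\sum_(b <- parts_after4 a l) b <= l * a l.+4)%N.
    rewrite big_map big_seq_cond.
    apply: (@leq_trans (\sum_(i <- iota 4 l | (i \in iota 4 l) && true) a l.+4)%N).
      apply: leq_sum => i; rewrite mem_iota andbT => /andP[_ il].
      have [->//|il'] := eqVneq i.+1 l.+4.
      by apply/ltnW/a_incr => //; lia.
    by rewrite -big_seq_cond big_const_seq count_predT size_iota iter_addn_0 mulnC.
  have := explicit_bound_suffices l0 (a_gt0 1%N isT) (a_incr 1%N 2%N isT isT)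
    (a_incr 2%N 3%N isT isT) (a_incr 3%N 4%N isT isT) (a_incr 4%N l.+4 isT l0) sg_le.
  set B := (2 * _ * _ * _ * _)%N => hB.
  have Bn : (B < n)%N.
    rewrite -(ltr_nat R); apply: le_lt_trans bn.
    rewrite /bound /B /= 4!natrM !natrX 2!natrM ler_peMr //.
    by rewrite -expR0 ler_expR divr_ge0.
  apply: pA_strong_log_concave => //; first exact: leq_ltn_trans Bn.
  exact: leq_trans hB (ltnW Bn).
split=> // n bn; rewrite /log_concave_at -(ltr_nat R) natrX natrM.
apply: le_lt_trans (main n bn).
rewrite -mulrA; apply: ler_peMl; first by rewrite mulr_ge0.
by rewrite lerDl divr_ge0 ?exprn_ge0.
Qed.
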